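(* Let $0\leq k\leq n$, and let $\Pi\mathrm{A}_n(k)$ be the subgroup of $\Pi\mathrm{A}_n$ consisting of those automorphisms that fix each of $x_1,\dots,x_k$ (so $\Pi\mathrm{A}_n(0)=\Pi\mathrm{A}_n$). Then $\Pi\mathrm{A}_n(k)$ is generated by the finite set $$\left[\Omega^{\pm1}(X)\cap\Pi\mathrm{A}_n(k)\right]\cup\{P_{ij}\mid k<i\leq n,\ 1\leq j\leq n,\ j\neq i\}.$$
   Context: Let $F_n$ be the free group on a fixed free basis $X=\{x_1,\dots,x_n\}$. A palindrome on $X$ is a word on $X^{\pm1}$ that reads the same backwards as forwards. The palindromic automorphism group $\Pi\mathrm{A}_n\leq\mathrm{Aut}(F_n)$ consists of those $\alpha$ such that each $\alpha(x_i)$ may be written as a palindrome on $X$. For $i\neq j$, $P_{ij}\in\Pi\mathrm{A}_n$ maps $x_i$ to $x_jx_ix_j$ and fixes $x_l$ for $l\neq i$. The inversion $\iota_j\in\Pi\mathrm{A}_n$ maps $x_j$ to $x_j^{-1}$ and fixes $x_l$ for $l\neq j$. $\Omega^{\pm1}(X)$ is the (finite) group of automorphisms generated by all inversions and all automorphisms permuting $X$. *)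

(* Defs.v *)
From HB Require Import structures.
From mathcomp Require Import all_boot perm.
From mathcomp Require Import boolp classical_sets cardinality.

Set Implicit Arguments.
Unset Strict Implicit.
Unset Printing Implicit Defensive.

Local Open Scope group_scope.
Local Open Scope classical_set_scope.

(* The letter (x, false) stands for x, and (x, true) for its inverse. *)
Notation letter X := (X * bool)%type.

Section Words.
Variable X : choiceType.

Implicit Types (l : letter X) (u v w : seq (letter X)).

Definition letterV l : letter X := (l.1, ~~ l.2).

Definition reduced w : bool := sorted (fun l l' => l' != letterV l) w.

Definition cons_reduce l w : seq (letter X) :=
  if w is l' :: w' then if l' == letterV l then w' else l :: w else [:: l].

Definition cat_reduce u v : seq (letter X) := foldr cons_reduce v u.

Definition reduce w : seq (letter X) := cat_reduce w [::].

Definition wordV w : seq (letter X) := rev (map letterV w).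

Lemma letterVK : involutive letterV.
Proof. by case=> x b; rewrite /letterV /= negbK. Qed.

Lemma reduced_cons l w : reduced (l :: w) -> reduced w.
Proof. exact: path_sorted. Qed.

Lemma reduced_cons_reduce l w : reduced w -> reduced (cons_reduce l w).
Proof.
case: w => [|l' w] //= rw; case: eqP => [_|/eqP ne]; first exact: path_sorted rw.
by rewrite /reduced /= ne.
Qed.

Lemma cons_reduceE l w : reduced (l :: w) -> cons_reduce l w = l :: w.
Proof. by case: w => [|l' w] //= /andP[/negPf-> _]. Qed.

Lemma cons_reduceK l w :
  reduced w -> cons_reduce (letterV l) (cons_reduce l w) = w.
Proof.
case: w => [|l' w] /=; first by rewrite letterVK eqxx.
move=> rw; case: eqP => [El|_] /=; last by rewrite letterVK eqxx.
by rewrite -El cons_reduceE.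
Qed.

Lemma reduced_cat_reduce u v : reduced v -> reduced (cat_reduce u v).
Proof. by move=> rv; elim: u => //= l u; apply: reduced_cons_reduce. Qed.

Lemma reduced_reduce w : reduced (reduce w).
Proof. exact: reduced_cat_reduce. Qed.

Lemma reduce_id w : reduced w -> reduce w = w.
Proof.
elim: w => //= l w IH rw.
by rewrite /reduce /= -/(reduce w) (IH (reduced_cons rw)) cons_reduceE.
Qed.

Lemma cat_reduce_cons l u v : reduced u -> reduced v ->
  cat_reduce (cons_reduce l u) v = cons_reduce l (cat_reduce u v).
Proof.
case: u => [|l' u] //= ru rv; case: eqP => [->|] //=.
have := cons_reduceK (letterV l) (reduced_cat_reduce u rv).
by rewrite letterVK => ->.
Qed.

Lemma cat_reduceA u v w : reduced v -> reduced w ->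
  cat_reduce u (cat_reduce v w) = cat_reduce (cat_reduce u v) w.
Proof.
move=> rv rw; elim: u => //= l u ->.
by rewrite cat_reduce_cons ?reduced_cat_reduce.
Qed.

Lemma wordV_cons l w : wordV (l :: w) = rcons (wordV w) (letterV l).
Proof. by rewrite /wordV /= rev_cons. Qed.

Lemma wordVK : involutive wordV.
Proof. by move=> w; rewrite /wordV map_rev revK mapK //; apply: letterVK. Qed.

Lemma reduced_wordV w : reduced w -> reduced (wordV w).
Proof.
rewrite /reduced /wordV rev_sorted sorted_map.
apply: sub_sorted => l l' /=.
by apply: contra => /eqP /(can_inj letterVK) ->; rewrite letterVK.
Qed.

Lemma cat_reduceV w v : reduced v -> cat_reduce (wordV w) (cat_reduce w v) = v.
Proof.
elim: w v => //= l w IH v rv; rewrite wordV_cons /cat_reduce foldr_rcons.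
by rewrite -/(cat_reduce w v) cons_reduceK ?reduced_cat_reduce // [LHS]IH.
Qed.

End Words.

Record free_group (X : choiceType) : Type :=
  FreeGroup { fg_word :> seq (letter X); fg_reduced : reduced fg_word }.

Section FreeGroup.
Variable X : choiceType.

HB.instance Definition _ := [isSub for @fg_word X].
HB.instance Definition _ := [Choice of free_group X by <:].
Implicit Types u v w : free_group X.

Definition fg_mul u v : free_group X :=
  FreeGroup (reduced_cat_reduce u (fg_reduced v)).
Definition fg_one : free_group X := @FreeGroup X [::] isT.
Definition fg_inv u : free_group X := FreeGroup (reduced_wordV (fg_reduced u)).

Lemma fg_mulA : associative fg_mul.
Proof. by move=> u v w; apply/val_inj/cat_reduceA; apply: fg_reduced. Qed.

Lemma fg_mul1 : left_id fg_one fg_mul.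
Proof. by move=> u; apply/val_inj. Qed.

Lemma fg_mulr1 : right_id fg_one fg_mul.
Proof. by move=> u; apply/val_inj/reduce_id/fg_reduced. Qed.

Lemma fg_mulV : left_inverse fg_one fg_inv fg_mul.
Proof.
move=> u; apply/val_inj; rewrite /= -{2}(reduce_id (fg_reduced u)).
exact: cat_reduceV.
Qed.

Lemma fg_mulrV : right_inverse fg_one fg_inv fg_mul.
Proof.
move=> u; rewrite -{1}[u](_ : fg_inv (fg_inv u) = u) ?fg_mulV //.
by apply/val_inj/wordVK.
Qed.

HB.instance Definition _ := isGroup.Build (free_group X)
  fg_mulA fg_mul1 fg_mulr1 fg_mulV fg_mulrV.

(* The element of the free group represented by an arbitrary word. *)
Definition fg_of_word (w : seq (letter X)) : free_group X :=
  FreeGroup (reduced_reduce w).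

Definition fg_gen (x : X) : free_group X := @FreeGroup X [:: (x, false)] isT.

Lemma fg_ind (P : free_group X -> Prop) :
  P 1 -> (forall x u, P u -> P (fg_gen x * u)) ->
  (forall x u, P u -> P ((fg_gen x)^-1 * u)) -> forall u, P u.
Proof.
move=> P1 Pg PV [w rw]; elim: w rw => [|[x b] w IH] rw.
  by rewrite (_ : FreeGroup rw = 1) //; apply/val_inj.
have rw' := reduced_cons rw; have Pw := IH rw'.
case: b rw => rw.
  rewrite (_ : FreeGroup rw = (fg_gen x)^-1 * FreeGroup rw'); first exact: PV.
  by apply/val_inj; rewrite /= cons_reduceE.
rewrite (_ : FreeGroup rw = fg_gen x * FreeGroup rw'); first exact: Pg.
by apply/val_inj; rewrite /= cons_reduceE.
Qed.

Section Lift.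
Variables (G : groupType) (f : X -> G).

Definition lift_letter (l : letter X) : G := if l.2 then (f l.1)^-1 else f l.1.
Definition lift_word (w : seq (letter X)) : G :=
  foldr (fun l g => lift_letter l * g) 1 w.
Definition fg_lift (u : free_group X) : G := lift_word u.

Lemma lift_cons_reduce (l : letter X) (w : seq (letter X)) :
  lift_word (cons_reduce l w) = lift_letter l * lift_word w.
Proof.
case: w => [|l' w] //=; case: eqP => [->|] //=.
rewrite mulgA -[LHS]mul1g; congr (_ * _).
by case: l => z [] /=; rewrite /lift_letter /= ?mulVg ?mulgV.
Qed.

Lemma fg_liftM : {morph fg_lift : u v / u * v}.
Proof.
move=> [u ru] [v rv]; rewrite /fg_lift /= => {ru rv}.
elim: u => [|l u IH] /=; first by rewrite mul1g.
by rewrite lift_cons_reduce IH mulgA.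
Qed.

Lemma fg_liftV u : fg_lift u^-1 = (fg_lift u)^-1.
Proof.
apply: (mulgI (fg_lift u)); rewrite -fg_liftM !mulgV.
by apply: (mulgI (fg_lift 1)); rewrite -fg_liftM !mulg1.
Qed.

Lemma fg_lift_gen x : fg_lift (fg_gen x) = f x.
Proof. exact: mulg1. Qed.

End Lift.

Lemma fg_hom_ext (G : groupType) (g h : free_group X -> G) :
  {morph g : u v / u * v} -> {morph h : u v / u * v} ->
  (forall x, g (fg_gen x) = h (fg_gen x)) -> g =1 h.
Proof.
move=> gM hM gh.
have hom1 (k : free_group X -> G) : {morph k : u v / u * v} -> k 1 = 1.
  by move=> kM; apply: (mulgI (k 1)); rewrite -kM !mulg1.
have homV (k : free_group X -> G) u : {morph k : u v / u * v} -> k u^-1 = (k u)^-1.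
  by move=> kM; apply: (mulgI (k u)); rewrite -kM !mulgV hom1.
elim/fg_ind => [|x u IH|x u IH]; first by rewrite !hom1.
  by rewrite gM hM gh IH.
by rewrite gM hM !homV // gh IH.
Qed.

End FreeGroup.

Record autom (G : groupType) : Type := Autom {
  autom_fun :> G -> G;
  autom_inv : G -> G;
  automM : {morph autom_fun : x y / x * y};
  automK : cancel autom_fun autom_inv;
  autom_invK : cancel autom_inv autom_fun
}.

Section AutomGroup.
Variable G : groupType.
Implicit Types a b : autom G.

HB.instance Definition _ := gen_eqMixin (autom G).
HB.instance Definition _ := gen_choiceMixin (autom G).

Lemma autom_ext a b : a =1 b -> a = b.
Proof.
case: a b => [f f' fM fK f'K] [g g' gM gK g'K] /= /funext fg.
subst g.
have e : f' = g' by apply/funext => x; rewrite -{1}(g'K x) fK.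
by subst g'; congr Autom; apply: Prop_irrelevance.
Qed.

Definition autom_one : autom G :=
  @Autom G id id (fun _ _ => erefl) (fun _ => erefl) (fun _ => erefl).

Definition autom_mul a b : autom G.
Proof.
exists (a \o b) (autom_inv b \o autom_inv a).
- by move=> x y /=; rewrite !automM.
- by apply: can_comp; apply: automK.
- by apply: can_comp; apply: autom_invK.
Defined.

Definition autom_invg a : autom G.
Proof.
exists (autom_inv a) a.
- by move=> x y; apply: (can_inj (automK a)); rewrite automM !autom_invK.
- exact: autom_invK.
- exact: automK.
Defined.

Lemma autom_mulA : associative autom_mul.
Proof. by move=> a b c; apply: autom_ext. Qed.

Lemma autom_mul1 : left_id autom_one autom_mul.
Proof. by move=> a; apply: autom_ext. Qed.

Lemma autom_mulr1 : right_id autom_one autom_mul.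
Proof. by move=> a; apply: autom_ext. Qed.

Lemma autom_mulV : left_inverse autom_one autom_invg autom_mul.
Proof. by move=> a; apply: autom_ext => x; apply: automK. Qed.

Lemma autom_mulrV : right_inverse autom_one autom_invg autom_mul.
Proof. by move=> a; apply: autom_ext => x; apply: autom_invK. Qed.

HB.instance Definition _ := isGroup.Build (autom G)
  autom_mulA autom_mul1 autom_mulr1 autom_mulV autom_mulrV.

End AutomGroup.

Definition is_subgroup (G : groupType) (H : set G) : Prop :=
  [/\ H 1, forall x y, H x -> H y -> H (x * y) & forall x, H x -> H x^-1].

Definition generated (G : groupType) (S : set G) : set G :=
  smallest (@is_subgroup G) S.

Lemma autom_fg_ext (X : choiceType) (a b : autom (free_group X)) :
  (forall x, a (fg_gen x) = b (fg_gen x)) -> a = b.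
Proof. by move=> ab; apply/autom_ext/fg_hom_ext => //; apply: automM. Qed.

Lemma exists_autom_fg (X : choiceType) (f g : X -> free_group X) :
  (forall x, fg_lift g (f x) = fg_gen x) ->
  (forall x, fg_lift f (g x) = fg_gen x) ->
  exists a : autom (free_group X), forall x, a (fg_gen x) = f x.
Proof.
move=> gf fg.
have fK : cancel (fg_lift f) (fg_lift g).
  apply: (@fg_hom_ext _ _ (fg_lift g \o fg_lift f) id) => [u v|//|z] /=.
    by rewrite !fg_liftM.
  by rewrite fg_lift_gen.
have gK : cancel (fg_lift g) (fg_lift f).
  apply: (@fg_hom_ext _ _ (fg_lift f \o fg_lift g) id) => [u v|//|z] /=.
    by rewrite !fg_liftM.
  by rewrite fg_lift_gen.
by exists (Autom (fg_liftM f) fK gK) => x; apply: fg_lift_gen.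
Qed.

Section PalindromicAutomorphisms.
Variable n : nat.

(* The basis element x_(i+1) of the text is [fg_gen i], i : 'I_n. *)
Local Notation F := (free_group 'I_n).
Local Notation x := (@fg_gen 'I_n).

(* Some word representing g, not necessarily reduced, is a palindrome. *)
Definition palindromic (g : F) : Prop :=
  exists2 w : seq (letter 'I_n), rev w = w & fg_of_word w = g.

Definition PiA : set (autom F) :=
  [set a | forall i, palindromic (a (x i))].

Definition PiA_fix (k : nat) : set (autom F) :=
  [set a | PiA a /\ forall i : 'I_n, (i < k)%N -> a (x i) = x i].

Definition is_P (i j : 'I_n) (a : autom F) : Prop :=
  a (x i) = x j * x i * x j /\ forall l, l != i -> a (x l) = x l.

Definition is_inversion (j : 'I_n) (a : autom F) : Prop :=
  a (x j) = (x j)^-1 /\ forall l, l != j -> a (x l) = x l.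

Lemma exists_unique_P i j : j != i -> exists! a, is_P i j a.
Proof.
move=> ji.
pose f l := if l == i then x j * x i * x j else x l.
pose g l := if l == i then (x j)^-1 * x i * (x j)^-1 else x l.
have [||a aE] := @exists_autom_fg _ f g.
- move=> l; rewrite /f; case: (eqVneq l i) => [->|li].
    rewrite !fg_liftM !fg_lift_gen /g eqxx (negPf ji).
    by rewrite !mulgA mulgV mul1g mulgVK.
  by rewrite fg_lift_gen /g (negPf li).
- move=> l; rewrite /g; case: (eqVneq l i) => [->|li].
    rewrite !fg_liftM !fg_liftV !fg_lift_gen /f eqxx (negPf ji).
    by rewrite !mulgA mulVg mul1g mulgK.
  by rewrite fg_lift_gen /f (negPf li).
exists a; split.
  by split=> [|l li]; rewrite aE /f ?eqxx ?(negPf li).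
move=> b [bi bl]; apply: autom_fg_ext => l; rewrite aE /f.
by case: (eqVneq l i) => [->|/bl].
Qed.

Lemma exists_unique_inversion j : exists! a, is_inversion j a.
Proof.
pose f l := if l == j then (x j)^-1 else x l.
have ff l : fg_lift f (f l) = x l.
  rewrite {2}/f; case: (eqVneq l j) => [->|lj].
    by rewrite fg_liftV fg_lift_gen /f eqxx invgK.
  by rewrite fg_lift_gen /f (negPf lj).
have [a aE] := exists_autom_fg ff ff.
exists a; split.
  by split=> [|l li]; rewrite aE /f ?eqxx ?(negPf li).
move=> b [bi bl]; apply: autom_fg_ext => l; rewrite aE /f.
by case: (eqVneq l j) => [->|/bl].
Qed.

Definition permutes_basis (a : autom F) : Prop :=
  exists s : {perm 'I_n}, forall i, a (x i) = x (s i).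

Definition Omega : set (autom F) :=
  generated ([set a | exists j, is_inversion j a] `|` permutes_basis).

End PalindromicAutomorphisms.

(* Main.v *)
(**
Palindromicity of [g] means that [g] is fixed by the anti-automorphism
[fg_rev] reversing words, so PiA is the centralizer of [fg_rev] and hence a
group.  For [a] in PiA each [a (x i)] is a palindrome of odd length
[h c (rev h)]; call [h c] its front half.  If the front half of [a l] is a
prefix of that of [a l'] for letters [l <> l'], then multiplying [a l'] on
both sides by the inverse of [a l] shortens it, and this is realized by
composing [a] with some [P i j] or its inverse; here [i >= k], since the
[x i] with [i < k] are fixed and have length one.  By induction on the total
length of the [a (x i)] we may assume that distinct front halves are
prefix-incomparable.  Then no cancellation in [a g] reaches the middle of a
factor, so [a g] starts with the front half of the image of the first letter
of [g].  As every letter is of the form [a g], every letter is the image of a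
letter, and [a] is a signed permutation of the basis.
*)
Require Import Defs.
From mathcomp Require Import all_boot perm zify.
From mathcomp Require Import boolp classical_sets cardinality.

Set Implicit Arguments.
Unset Strict Implicit.
Unset Printing Implicit Defensive.

Local Open Scope classical_set_scope.
Local Open Scope group_scope.

(** * Reduced words, cancellation and parity of length *)

Section FreeGroupWords.
Variable X : choiceType.
Implicit Types (l c z : letter X) (u v w s h : seq (letter X)) (g : free_group X).

Lemma reduced_rev {w} : reduced w -> reduced (rev w).
Proof.
rewrite /reduced rev_sorted; apply: sub_sorted => l l'.
by apply: contra => /eqP->; rewrite letterVK.
Qed.

Lemma reduced_catl {u v} : reduced (u ++ v) -> reduced u.
Proof. by case: u => // l u; rewrite /reduced /= cat_path => /andP[]. Qed.

Lemma cat_reduceE {u v} : reduced (u ++ v) -> cat_reduce u v = u ++ v.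
Proof.
elim: u => //= l u IH ruv.
by rewrite IH ?cons_reduceE ?(reduced_cons ruv).
Qed.

Lemma reduced_cat_cons {u l v} :
  reduced (rcons u l) -> reduced (l :: v) -> reduced (u ++ l :: v).
Proof.
case: u => [|l' u] //=; rewrite /reduced /= rcons_path cat_path /=.
by move=> /andP[-> ->].
Qed.

Lemma size_cons_reduce l u : (size (cons_reduce l u) <= (size u).+1)%N.
Proof. by case: u => [|l' u] //=; case: ifP => //= _; rewrite -addn2 leq_addr. Qed.

Lemma odd_cons_reduce l u : odd (size (cons_reduce l u)) = ~~ odd (size u).
Proof. by case: u => [|l' u] //=; case: ifP => //= _; rewrite negbK. Qed.

Lemma size_cat_reduce u v : (size (cat_reduce u v) <= size u + size v)%N.
Proof. by elim: u => //= l u IH; apply: leq_trans (size_cons_reduce _ _) _. Qed.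

(** Letters cancel in pairs, so parity of length is additive; this later rules out products
    [g * fg_rev g] as single letters. *)
Lemma odd_cat_reduce u v :
  odd (size (cat_reduce u v)) = odd (size u) (+) odd (size v).
Proof. by elim: u => //= l u IH; rewrite odd_cons_reduce IH addNb. Qed.

Lemma wordV_rcons s l : wordV (rcons s l) = letterV l :: wordV s.
Proof. by rewrite /wordV map_rcons rev_rcons. Qed.

(** To cancel [c], [w] must first consume all of [s], hence begin with the inverse of [c :: s].
    Induction strips letters off the end of [s]: each one cancels the head of [w], or no further
    cancellation occurs. *)
Lemma prefix_cat_reduce h c s w :
  reduced (rcons h c ++ s) -> reduced w -> ~~ prefix (wordV (c :: s)) w ->
  prefix (rcons h c) (cat_reduce (rcons h c ++ s) w).
Proof.
elim/last_ind: s w => [|s z IH] w.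
  rewrite cats0 => rhc; case: w => [|l w] rw.
    by rewrite -[cat_reduce _ _]/(reduce _) reduce_id // prefix_refl.
  rewrite -[wordV [:: c]]/[:: letterV c] prefix_cons prefix0s andbT => ne.
  have rcw : reduced [:: c, l & w] by rewrite /reduced /= eq_sym ne.
  by rewrite cat_reduceE ?prefix_prefix // cat_rcons reduced_cat_cons.
move=> rhcs rw; rewrite -[c :: rcons s z]/(rcons (c :: s) z) wordV_rcons -rcons_cat.
have rhcs' : reduced (rcons h c ++ s).
  by apply: (@reduced_catl _ [:: z]); rewrite cats1 rcons_cat.
rewrite /cat_reduce foldr_rcons -/(cat_reduce _ _).
case: w rw => [|l w] rw; rewrite ?prefix_cons /=.
  rewrite cat_reduceE; first by rewrite -catA prefix_prefix.
  by rewrite cats1 rcons_cat.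
rewrite eq_sym; case: eqP => [_ /= | /eqP ne _]; first exact/IH/(reduced_cons rw).
rewrite cat_reduceE; first by rewrite -catA prefix_prefix.
apply: reduced_cat_cons; first by rewrite rcons_cat.
by rewrite /reduced /= ne.
Qed.

Lemma fg_of_word_id g : fg_of_word g = g.
Proof. by apply/val_inj/reduce_id/fg_reduced. Qed.

Lemma fg_of_word_cat u v : fg_of_word (u ++ v) = fg_of_word u * fg_of_word v.
Proof.
apply/val_inj; rewrite /= {1}/reduce /cat_reduce foldr_cat.
exact: (cat_reduceA u (v := [::]) isT (reduced_reduce v)).
Qed.

Lemma size_fg_of_word w : (size (fg_of_word w) <= size w)%N.
Proof. by rewrite -[leqRHS]addn0; apply: size_cat_reduce. Qed.

Lemma size_fg_inv g : size g^-1 = size g.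
Proof. by rewrite /= size_rev size_map. Qed.

(** * Letters as group elements; reversal as an anti-automorphism *)

Definition fg_letter l : free_group X := lift_letter (@fg_gen X) l.

Lemma fg_word_letter l : fg_letter l = [:: l] :> seq _.
Proof. by case: l => y []. Qed.

Lemma fg_letterV l : fg_letter (letterV l) = (fg_letter l)^-1.
Proof. by case: l => y []; rewrite /fg_letter /lift_letter /= ?invgK. Qed.

Lemma fg_letter_inj : injective fg_letter.
Proof. by move=> l l' /(congr1 (@fg_word X)); rewrite !fg_word_letter => -[]. Qed.

Lemma fg_word_cons {g l w} (e : fg_word g = l :: w) :
  exists2 g', fg_word g' = w & g = fg_letter l * g'.
Proof.
have := fg_reduced g; rewrite e => rlw.
exists (FreeGroup (reduced_cons rlw)) => //.
by apply/val_inj; rewrite /= fg_word_letter /= e cons_reduceE.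
Qed.

Definition fg_rev g : free_group X := FreeGroup (reduced_rev (fg_reduced g)).

Lemma fg_revK : involutive fg_rev.
Proof. by move=> g; apply/val_inj; rewrite /= revK. Qed.

Lemma fg_of_word_inv w : fg_of_word (wordV w) = (fg_of_word w)^-1.
Proof.
elim: w => [|l w IH]; first by apply/val_inj.
rewrite wordV_cons -cats1 fg_of_word_cat IH -[l :: w]cat1s fg_of_word_cat invgM.
by congr (_ * _); apply/val_inj.
Qed.

(** Inverting every generator and then the whole element reverses words. This recipe depends only on
    the group element, so reduction before reversal is harmless. *)
Lemma fg_rev_of_word w : fg_rev (fg_of_word w) = fg_of_word (rev w).
Proof.
pose inv_gen (y : X) := (fg_gen y)^-1.
have revE v : (fg_lift inv_gen (fg_of_word v))^-1 = fg_of_word (rev v).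
  elim: v => [|[y b] v IH]; first by rewrite invg1; apply/val_inj.
  rewrite -[(y, b) :: v]cat1s rev_cat !fg_of_word_cat fg_liftM invgM IH.
  congr (_ * _).
  by case: b; apply/val_inj.
rewrite -[in RHS]revE -[X in fg_lift _ X]fg_of_word_id revE.
by apply/val_inj; rewrite /= (reduce_id (reduced_rev (reduced_reduce w))).
Qed.

Lemma fg_revM g1 g2 : fg_rev (g1 * g2) = fg_rev g2 * fg_rev g1.
Proof.
rewrite -[g1]fg_of_word_id -[g2]fg_of_word_id -fg_of_word_cat.
by rewrite !fg_rev_of_word rev_cat fg_of_word_cat.
Qed.

End FreeGroupWords.

(** * Odd palindromes and their front halves *)

Section OddPalindromes.
Variable X : choiceType.
Implicit Types (l c : letter X) (u v w h : seq (letter X)) (g : free_group X).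

(** The [.+1] includes the middle letter of a word of odd length. *)
Definition front_half w := take (size w)./2.+1 w.

Lemma front_half_cat h c v : size v = size h ->
  front_half (rcons h c ++ v) = rcons h c.
Proof.
move=> sv; apply: take_size_cat.
by rewrite size_cat size_rcons sv addSn addnn /= uphalf_double.
Qed.

Lemma odd_palindromeE {w} : rev w = w -> odd (size w) ->
  exists h c, w = rcons h c ++ rev h.
Proof.
move=> rw ow; have sw := odd_double_half (size w); rewrite ow add1n in sw.
have lt : ((size w)./2 < size w)%N by rewrite -[ltnRHS]sw ltnS -addnn leq_addr.
case: w => [|l0 w0] // in rw ow sw lt *; set w := l0 :: w0 in rw ow sw lt *.
exists (take (size w)./2 w), (nth l0 w (size w)./2).
rewrite -take_nth // -{1}(cat_take_drop (size w)./2.+1 w); congr (_ ++ _).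
rewrite -{4}rw rev_take ?revK size_rev //.
by congr drop; rewrite -{2}sw -addnn -addSn addnK.
Qed.

Lemma even_palindromeE {w} : rev w = w -> ~~ odd (size w) ->
  exists h, w = h ++ rev h.
Proof.
move=> rw /even_halfK sw; exists (take (size w)./2 w).
rewrite -{1}(cat_take_drop (size w)./2 w); congr (_ ++ _).
rewrite -{4}rw rev_take ?revK size_rev //.
by congr drop; rewrite -{2}sw -addnn addnK.
Qed.

Lemma prefix_total {u v w} : prefix u w -> prefix v w -> prefix u v || prefix v u.
Proof.
elim: w u v => [|l w IH] [|lu u] [|lv v] //.
rewrite !prefix_cons => /andP[/eqP-> pu] /andP[/eqP-> pv].
by rewrite eqxx /=; apply: IH.
Qed.

(** If [v] is $h\,c\,\bar h$ with $\bar h$ the reversal of $h$, then either $u=v$ or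
    $u=h\,c\,y\,c\,\bar h$. In the latter case $v^{-1}uv^{-1}=\bar h^{-1}yh^{-1}$, and the lengths
    compare directly. *)
Lemma front_half_prefix_reduction (u v : free_group X) :
  rev u = u -> rev v = v -> odd (size u) -> odd (size v) ->
  prefix (front_half v) (front_half u) ->
  u = v \/ (size v < size u)%N /\ (size (v^-1 * u * v^-1)%g < size u)%N.
Proof.
move=> ru rv ou ov.
have [[h' [c' uE]] [h [c vE]]] := (odd_palindromeE ru ou, odd_palindromeE rv ov).
rewrite uE vE !front_half_cat ?size_rev // => /prefixP[t].
elim/last_ind: t => [|t z _].
  rewrite cats0 => /rcons_inj[hE cE]; left; apply/val_inj.
  by rewrite /= uE vE hE cE.
rewrite -rcons_cat => /rcons_inj[hE zE]; right.
pose y := rcons t c' ++ rev t.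
have uE' : fg_word u = h ++ [:: c] ++ y ++ [:: c] ++ rev h.
  by rewrite uE hE rev_cat rev_rcons /y -!cats1 -!catA.
rewrite -uE -vE.
have lt_vu : (size (rcons h c ++ rev h) + size y < size u)%N.
  by rewrite uE' !size_cat size_rcons /=; lia.
split; first by rewrite [X in (size X < _)%N]vE (leq_ltn_trans _ lt_vu) ?leq_addr.
have -> : v^-1 * u * v^-1 = fg_of_word (wordV (rev h) ++ y ++ wordV h).
  rewrite -[in LHS](fg_of_word_id u) -[in LHS](fg_of_word_id v) uE' vE -cats1.
  rewrite -!catA !fg_of_word_cat !fg_of_word_inv !invgM !mulgA.
  by rewrite !mulgVK !mulgK.
apply: leq_ltn_trans (size_fg_of_word _) _.
apply: leq_ltn_trans lt_vu.
by rewrite !size_cat ![size (wordV _)]size_rev !size_map !size_rev size_rcons; lia.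
Qed.

End OddPalindromes.

(** * Finiteness by parametrization; generalities on automorphisms *)

Lemma finite_parametrized (T : finType) (U : choiceType) (R : T -> U -> Prop) :
  (forall t u v, R t u -> R t v -> u = v) ->
  finite_set [set u | exists t, R t u].
Proof.
move=> R_uniq; have [-> //|/set0P[u0 _]] := eqVneq [set u | exists t, R t u] set0.
(* [u0] is the default value for parameters related to no element. *)
apply: (@sub_finite_set _ _ [set xget u0 [set u | R t u] | t in [set: T]]).
  move=> u [t Rtu]; exists t => //; apply: xget_unique => // v Rtv.
  exact: R_uniq Rtv Rtu.
exact/finite_image/finite_finset.
Qed.

Section Automorphisms.
Variable G : groupType.
Implicit Types (a b : autom G) (S : set (autom G)).

Lemma autom_mulE a b g : (a * b) g = a (b g).
Proof. by []. Qed.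

Lemma autom1 a : a 1 = 1.
Proof. by apply: (mulgI (a 1)); rewrite -automM !mulg1. Qed.

Lemma automV a g : a g^-1 = (a g)^-1.
Proof. by apply: (mulgI (a g)); rewrite -automM !mulgV autom1. Qed.

Lemma autom_inj a : injective a.
Proof. exact: can_inj (automK a). Qed.

Lemma subgroup_generated S : is_subgroup (generated S).
Proof.
split=> [H [[H1 _ _] _] //|a b Sa Sb H HS|a Sa H HS].
  by have [[_ HM _] _] := HS; apply: HM; [apply: Sa|apply: Sb].
by have [[_ _ HV] _] := HS; apply: HV; apply: Sa.
Qed.

End Automorphisms.

(** * Palindromic automorphisms and Nielsen reduction *)

Section PalindromicAutomorphisms.
Variable n : nat.
Local Notation F := (free_group 'I_n).
Local Notation x := (@fg_gen 'I_n).
Implicit Types (l : letter 'I_n) (g : F) (a p : autom F).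

Lemma palindromicP g : palindromic g <-> fg_rev g = g.
Proof.
split=> [[w rw <-]|rg]; first by rewrite fg_rev_of_word rw.
by exists (fg_word g); [have /(congr1 (@fg_word _)) := rg|apply: fg_of_word_id].
Qed.

(** Conjugating [a] by the anti-automorphism [fg_rev] gives a homomorphism, which need only be
    compared with [a] on the generators, themselves fixed by [fg_rev]. *)
Lemma PiA_revP a : PiA a <-> forall g, a (fg_rev g) = fg_rev (a g).
Proof.
split=> [Pa g|aR i].
  rewrite -[LHS]fg_revK; congr fg_rev.
  apply: (@fg_hom_ext _ _ (fun h => fg_rev (a (fg_rev h))) a) => [u v|u v|i].
  - by rewrite fg_revM automM fg_revM.
  - exact: automM.
  - by rewrite [fg_rev (x i)](_ : _ = x i); [apply/palindromicP/Pa|apply/val_inj].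
by apply/palindromicP; rewrite -aR; congr (a _); apply/val_inj.
Qed.

Lemma PiA_fix_subgroup k : is_subgroup (@PiA_fix n k).
Proof.
split=> [|a b [/PiA_revP aR ax] [/PiA_revP bR bx]|a [/PiA_revP aR ax]].
- by split=> //; apply/PiA_revP.
- split=> [|i ik]; first by apply/PiA_revP => g; rewrite !autom_mulE bR aR.
  by rewrite autom_mulE bx // ax.
- split=> [|i ik]; last by apply: (@autom_inj _ a); rewrite ax // -autom_mulE mulgV.
  apply/PiA_revP => g; apply: (@autom_inj _ a).
  by rewrite aR -!autom_mulE mulgV.
Qed.

Lemma is_P_inv {i j : 'I_n} {p} : j != i -> is_P i j p ->
  p^-1 (x i) = (x j)^-1 * x i * (x j)^-1 /\ forall m, m != i -> p^-1 (x m) = x m.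
Proof.
move=> ji [pi pl]; split=> [|l li]; apply: (@autom_inj _ p).
  by rewrite -autom_mulE mulgV !automM automV pi pl // !mulgA mulVg mul1g mulgK.
by rewrite -autom_mulE mulgV pl.
Qed.

Lemma is_P_PiA_fix {k} {i j : 'I_n} {p} : (k <= i)%N -> is_P i j p -> PiA_fix k p.
Proof.
move=> ki [pi pl]; split=> [l|l lk].
  have [->|/pl->] := eqVneq l i; last by exists [:: (l, false)] => //; apply/val_inj.
  rewrite pi; exists [:: (j, false); (i, false); (j, false)] => //.
  by rewrite -[[:: _; _; _]]/([:: (j, false)] ++ [:: (i, false)] ++ [:: (j, false)])
     !fg_of_word_cat mulgA; do !congr (_ * _); apply/val_inj.
by apply: pl; apply: contraTneq lk => ->; rewrite -leqNgt.
Qed.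

(* If [a (x i)] were an even palindrome, it would be [g * fg_rev g]; applying
   the inverse of [a] would make [x i] of that form too, hence of even length. *)
Lemma odd_size_PiA {a} i : PiA a -> odd (size (a (x i))).
Proof.
move=> Pa; have /palindromicP /(congr1 (@fg_word _)) /= ra := Pa i.
apply/negPn/negP => /(even_palindromeE ra)[h aE].
have {}aE : a (x i) = fg_of_word h * fg_rev (fg_of_word h).
  by rewrite fg_rev_of_word -fg_of_word_cat -aE fg_of_word_id.
have xE : x i = a^-1 (fg_of_word h) * fg_rev (a^-1 (fg_of_word h)).
  apply: (@autom_inj _ a); rewrite automM.
  by move/PiA_revP: Pa => ->; rewrite -autom_mulE mulgV.
have /(congr1 odd) : size (x i) = 1%N by [].
by rewrite xE odd_cat_reduce size_rev addbb.
Qed.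

Lemma odd_size_letter {a} l : PiA a -> odd (size (a (fg_letter l))).
Proof.
by case: l => i [] Pa; rewrite /fg_letter /lift_letter /=
  ?automV ?size_fg_inv odd_size_PiA.
Qed.

Lemma rev_letter {a} l : PiA a -> rev (a (fg_letter l)) = a (fg_letter l).
Proof.
move=> /PiA_revP aR; rewrite -[LHS]/(fg_word (fg_rev _)) -aR.
by congr (fg_word (a _)); apply/val_inj; rewrite /= fg_word_letter.
Qed.

Lemma fg_letter_false i : fg_letter (i, false) = x i.
Proof. by []. Qed.

Lemma Nielsen_reduction_step {k a} : PiA_fix k a ->
  (exists (i j : 'I_n) b, [/\ (k <= i)%N, j != i &
    (size (a (fg_letter (j, b)) * a (x i) * a (fg_letter (j, b)))%g
       < size (a (x i)))%N]) \/
  (forall l l', prefix (front_half (a (fg_letter l)))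
                       (front_half (a (fg_letter l'))) -> l = l').
Proof.
move=> [Pa ax]; set red := (X in X \/ _).
have [|no_red] := pselect red; [by left|right].
move=> l l' /front_half_prefix_reduction.
case; rewrite ?rev_letter ?odd_size_letter //; first by move/autom_inj/fg_letter_inj.
move=> [lt_size lt_red].
have [eq_i|ne_i] := eqVneq l.1 l'.1.
  have [//|ne_b] := eqVneq l.2 l'.2; first by
    case: l l' eq_i {lt_size lt_red} => ? ? [? ?] /= -> ->.
  (* Mutually inverse letters have images of equal length, against [lt_size]. *)
  have lV : l' = letterV l.
    case: l l' eq_i ne_b {lt_size lt_red} => y b [y' b'] /= -> ne.
    by congr pair; case: b b' ne => [] [].
  by move: lt_size; rewrite lV fg_letterV automV size_fg_inv ltnn.
have [lt_k|le_k] := ltnP l'.1 k.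
  (* A fixed generator has an image of length one, and no odd length is smaller. *)
  have s1 : size (a (fg_letter l')) = 1%N.
    by case: l' lt_k {lt_size lt_red ne_i} => i [] /= ik;
       rewrite /fg_letter /lift_letter /= ?automV ?size_fg_inv ax.
  move: lt_size (odd_size_letter l Pa); rewrite s1.
  by case: (size _).
case: no_red; case: l' le_k ne_i lt_red {lt_size} => i [] /= ik ji lt_red.
  exists i, l.1, l.2; split=> //; rewrite -surjective_pairing.
  have aV : a (fg_letter (i, true)) = (a (x i))^-1 := automV _ _.
  (* For [l'] an inverse letter, the inequality is inverted to concern [x i]. *)
  rewrite -[ltnLHS]size_fg_inv -[ltnRHS]size_fg_inv !invgM mulgA -aV.
  exact: lt_red.
exists i, l.1, (~~ l.2); split=> //; rewrite -[(_, _)]/(letterV l) fg_letterV automV.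
exact: lt_red.
Qed.

(** * Automorphisms with prefix-incomparable front halves *)

Section Incomparable.
Variable a : autom F.
Hypotheses (Pa : PiA a)
  (incomparable : forall l l', prefix (front_half (a (fg_letter l)))
                       (front_half (a (fg_letter l'))) -> l = l').

(** Cancelling the middle letter of the image of [l] would make the image of the remaining word
    begin with the front half for [letterV l]. By induction it begins with that for [l'], so
    incomparability forces [l' = letterV l], and [g] would not be reduced. *)
Lemma prefix_front_half l w g : fg_word g = l :: w ->
  prefix (front_half (a (fg_letter l))) (a g).
Proof.
elim: w l g => [|l' w IH] l g gE.
all: have [g' wE gE'] := fg_word_cons gE.
all: rewrite gE' automM /=.
all: have [h [c lE]] := odd_palindromeE (rev_letter l Pa) (odd_size_letter l Pa).
all: rewrite lE front_half_cat ?size_rev //.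
all: apply: prefix_cat_reduce; [by rewrite -lE fg_reduced | exact: fg_reduced | ].
  have -> : g' = 1 by apply/val_inj.
  by rewrite autom1 wordV_cons prefixs0; case: (wordV _).
have pre' := IH _ _ wE; apply: contraT; rewrite negbK => pre.
have VE : wordV (c :: rev h) = front_half (a (fg_letter (letterV l))).
  rewrite fg_letterV automV /= lE /front_half.
  rewrite cat_rcons /wordV map_cat rev_cat take_size_cat //.
  by rewrite !size_cat !size_rev !size_map /= size_rev addnn uphalf_double.
have := fg_reduced g; rewrite gE /= => /andP[/eqP ne _]; case: ne.
move: pre; rewrite VE => pre.
by case/orP: (prefix_total pre pre') => /incomparable.
Qed.

Lemma letters_to_letters l : exists l', a (fg_letter l) = fg_letter l'.
Proof.
have surj z : exists l', a (fg_letter l') = fg_letter z.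
  pose g := a^-1 (fg_letter z).
  have aE : a g = fg_letter z by rewrite -autom_mulE mulgV.
  case gE : (fg_word g) => [|l' w].
    have g1 : g = 1 by apply/val_inj.
    by move: aE; rewrite g1 autom1 => /(congr1 (@fg_word _)); rewrite fg_word_letter.
  have := prefix_front_half gE; rewrite aE fg_word_letter.
  have [h [c lE]] := odd_palindromeE (rev_letter l' Pa) (odd_size_letter l' Pa).
  rewrite lE front_half_cat ?size_rev // prefixs1; case: h lE => [|y h] lE //=.
    by case/eqP=> cz; exists l'; apply/val_inj; rewrite /= lE fg_word_letter cz.
  by case/eqP=> _; case: (h).
(* Preimages of letters give an injective self-map of the finite set of letters; its inverse
   describes [a]. *)
have [f fE] := choice surj.
have f_inj : injective f.
  by move=> z z' ff; apply: fg_letter_inj; rewrite -fE ff fE.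
by exists (invF f_inj l); rewrite -[RHS]fE f_invF.
Qed.

End Incomparable.

(** * Signed permutations of the basis *)

Definition signed : set (autom F) :=
  [set a | exists f : 'I_n -> letter 'I_n, forall i, a (x i) = fg_letter (f i)].

(** Injectivity of [a] passes to the map on letters, a finite set, so [signed] indeed describes
    signed permutations. *)
Lemma signed_letters a : signed a ->
  exists2 f : letter 'I_n -> letter 'I_n, injective f
    & forall l, a (fg_letter l) = fg_letter (f l).
Proof.
move=> [f aE].
have [l|h hE] := @choice _ _ (fun l l' => a (fg_letter l) = fg_letter l').
  case: l => i []; last by exists (f i); apply: aE.
  exists (letterV (f i)); rewrite fg_letterV -aE; exact: automV.
by exists h => // l l' ll; apply/fg_letter_inj/(@autom_inj _ a); rewrite !hE ll.
Qed.

Lemma signed_subgroup : is_subgroup signed.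
Proof.
split=> [|a b /signed_letters[f _ fE] [g gE]|a /signed_letters[f f_inj fE]].
- by exists (fun i => (i, false)).
- by exists (f \o g) => i; rewrite autom_mulE gE fE.
- exists (fun i => invF f_inj (i, false)) => i.
  by apply: (@autom_inj _ a); rewrite -autom_mulE mulgV fE f_invF.
Qed.

Lemma Omega_signed : @Omega n = signed.
Proof.
apply/seteqP; split.
  apply: smallest_sub; first exact: signed_subgroup.
  move=> a [[j [aj al]]|[s aE]]; last by exists (fun i => (s i, false)).
  exists (fun i => (i, i == j)) => i.
  by have [->|ij] := eqVneq i j; rewrite ?aj ?al.
have [_ OmM OmV] :=
  subgroup_generated ([set a | exists j, is_inversion j a] `|` @permutes_basis n).
(* Induction on the number of generators sent to inverse letters; precomposing with the inversion of
   such a generator removes one. *)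
move=> a [f aE]; have [m] := ubnP #|[pred i | (f i).2]|.
elim: m a f aE => // m IH a f aE; rewrite ltnS => le_m.
have [[j fj]|no_neg] := pselect (exists j, (f j).2).
  have [p [[pj pl] _]] := exists_unique_inversion j.
  have p_gen : Omega p by apply: sub_gen_smallest; left; exists j.
  rewrite -(mulgK p a); apply: (OmM _ _ _ (OmV _ p_gen)).
  apply: (IH _ (fun i => if i == j then letterV (f j) else f i)) => [i|].
    rewrite autom_mulE; have [->|/pl->//] := eqVneq i j.
    by rewrite pj automV aE fg_letterV.
  apply: leq_trans le_m; apply: proper_card; apply/properP; split.
    by apply/fintype.subsetP=> i; rewrite !inE; case: eqP => // _; rewrite /= fj.
  by exists j; rewrite !inE // eqxx /= fj.
have fE i : f i = ((f i).1, false).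
  by case fi : (f i) => [y []] //; case: no_neg; exists i; rewrite fi.
have f_inj : injective (fun i => (f i).1).
  move=> i i' ii; suff: (i, false) = (i', false) by case.
  by apply/fg_letter_inj/(@autom_inj _ a); rewrite !fg_letter_false !aE fE ii -fE.
apply: sub_gen_smallest; right; exists (perm f_inj) => i.
by rewrite aE fE permE.
Qed.

End PalindromicAutomorphisms.

(** * Finiteness of the generating set, and generation by induction on length *)

Unset Implicit Arguments.

Theorem proposition2p2 (n k : nat) (hk : (k <= n)%N) :
  let S : set (autom (free_group 'I_n)) :=
    (@Omega n `&` @PiA_fix n k) `|`
    [set a | exists i j : 'I_n, [/\ (k <= i)%N, j != i & is_P i j a]] in
  finite_set S /\ generated S = @PiA_fix n k.
Proof.
move=> S; split.
  rewrite finite_setU; split.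
    apply: (@sub_finite_set _ _ (@signed n)).
      by rewrite -Omega_signed; apply: subIsetl.
    apply: (@sub_finite_set _ _ [set a : autom (free_group 'I_n) |
              exists f : {ffun 'I_n -> letter 'I_n},
              forall i, a (fg_gen i) = fg_letter (f i)]).
      by move=> a [f aE]; exists (finfun f) => i; rewrite aE ffunE.
    apply: finite_parametrized => f a b aE bE; apply: autom_fg_ext => i.
    by rewrite aE bE.
  apply: (@sub_finite_set _ _ [set a | exists ij : 'I_n * 'I_n,
            ij.2 != ij.1 /\ is_P ij.1 ij.2 a]).
    by move=> a [i [j [_ ji aP]]]; exists (i, j).
  apply: finite_parametrized => -[i j] a b [/= /exists_unique_P[p [_ pU]] /pU <-].
  by case=> _ /pU.
apply/seteqP; split.
  apply: smallest_sub; first exact: PiA_fix_subgroup.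
  by move=> a [[]//|[i [j [ki _ aP]]]]; apply: is_P_PiA_fix aP.
have [_ GM GV] := subgroup_generated S.
move=> a; have [m] := ubnP (\sum_(i < n) size (a (fg_gen i))).
elim: m a => // m IH a; rewrite ltnS => le_m Pa.
have [[i [j [b [ki ji lt_red]]]]|incomp] := Nielsen_reduction_step Pa; last first.
  apply: sub_gen_smallest; left; split=> //; rewrite Omega_signed.
  have [f fE] := choice (letters_to_letters Pa.1 incomp).
  by exists (fun i => f (i, false)) => i; rewrite -fE.
(* [p] is $P_{ij}$ or its inverse, according to the sign [b]; then [a * p] sends [x i] to the
   shortened product. *)
have [p [Gp Pp [pi pl]]] : exists p, [/\ generated S p, PiA_fix k p &
    p (fg_gen i) = fg_letter (j, b) * fg_gen i * fg_letter (j, b) /\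
    forall m, m != i -> p (fg_gen m) = fg_gen m].
  have [q [qP _]] := exists_unique_P ji.
  have Gq : generated S q by apply: sub_gen_smallest; right; exists i, j.
  have Pq := is_P_PiA_fix ki qP.
  case: b {lt_red}; last by exists q.
  exists q^-1; split; [exact: GV | | exact: is_P_inv].
  by have [_ _] := PiA_fix_subgroup n k; apply.
rewrite -(mulgK p a); apply: (GM _ _ _ (GV _ Gp)); apply: IH; last first.
  by have [_ + _] := PiA_fix_subgroup n k; apply.
(* Only the summand at [i] changes, and it strictly decreases. *)
apply: leq_trans le_m; rewrite (bigD1 i) //= [ltnRHS](bigD1 i) //=.
rewrite pi !automM -addSn leq_add //.
by apply: leq_sum => l li; rewrite pl.
Qed.
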